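(* Let $0 \le m \le n$ be integers, let $B^m$ and $B^n$ be the Bernstein bases of $\mathcal{P}_m$ and $\mathcal{P}_n$, let $\Lambda^n=[\lambda_0^n,\ldots,\lambda_n^n]$ be the dual Bernstein functionals on $\mathcal{P}_n$, and let $E$ be the degree elevation matrix. Then: (1) The embedding of $\mathcal{P}_m$ (with basis $B^m$ and dual map $\Lambda^m$) into $\mathcal{P}_n$ (with basis $B^n$ and dual map $\Lambda^n$) is complete: for every injective map $s:\{0,\ldots,m\}\to\{0,\ldots,n\}$, the functionals $\lambda^n_{s(0)},\ldots,\lambda^n_{s(m)}$ are linearly independent on $\mathcal{P}_m$. (2) For every injective map $s:\{0,\ldots,m\}\to\{0,\ldots,n\}$, the basis $D^m=[D^m_0,\ldots,D^m_m]$ of $\mathcal{P}_m$ dual to $\Lambda^n(s)$ (i.e. $\lambda^n_{s(i)} D^m_j=\delta_{ij}$ for $0\le i,j\le m$) can be represented as $D^m=B^mE(s,:)^{-1}$, with $D^m=B^m$ when $m=n$.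
   Context: $\mathcal{P}_n$ is the space of real polynomials of degree at most $n$. The Bernstein basis is the row vector $B^n=[B_0^n,\ldots,B_n^n]$ with $B_i^n(t)=\binom{n}{i}(1-t)^{n-i}t^i$. The dual Bernstein functionals are $\lambda_k^n f=\sum_{j=0}^k \frac{\binom{k}{j}}{\binom{n}{j}}\frac{1}{j!}f^{(j)}(0)$, $0\le k\le n$; they satisfy $\lambda_k^nB_i^n=\delta_{ki}$. The degree elevation matrix $E$ is the $(n+1)\times(m+1)$ matrix, with rows indexed by $0\le i\le n$ and columns by $0\le j\le m$, with entries $E(i,j)=\binom{n-i}{m-j}\binom{i}{j}/\binom{n}{m}$ (zero if $i<j$ or $n-i<m-j$); it satisfies $B^m=B^nE$. For an injective map (selection) $s:\{0,\ldots,m\}\to\{0,\ldots,n\}$, $\Lambda^n(s)=[\lambda^n_{s(0)},\ldots,\lambda^n_{s(m)}]$ and $E(s,:)$ is the $(m+1)\times(m+1)$ matrix with entries $E(s(i),j)$. Functionals are linearly independent on $\mathcal{P}_m$ if their restrictions to $\mathcal{P}_m$ are linearly independent.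
   Formalization: The clause ''D^m = B^m when m = n'' fails as an equality of ordered rows when s is a nontrivial permutation (m = n = 1, s the swap: D_0 = B_1); it is replaced by D^m_j = B^m_{s(j)} for every s, and D^m = B^m when s is the identity. *)

(* Defs.v *)
From HB Require Import structures.
From mathcomp Require Import all_boot all_order all_algebra.
From mathcomp Require Import reals.

Set Implicit Arguments.
Unset Strict Implicit.
Unset Printing Implicit Defensive.

Import GRing.Theory.
Local Open Scope ring_scope.

(* Polynomials of degree at most m form the vector space {poly_m.+1 R}
   (polynomials of size at most m.+1). *)

Definition bernstein (R : realType) (n i : nat) : {poly R} :=
  'C(n, i)%:R *: ((1 - 'X) ^+ (n - i) * 'X ^+ i).

Definition bernstein_row (R : realType) (n : nat) : 'rV[{poly R}]_n.+1 :=
  \row_(i < n.+1) bernstein R n i.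

(* The codomain R^o is R seen as a module over itself, so that the functionals
   can be packed as linear maps. *)
Definition dual_bernstein (R : realType) (n : nat) (k : 'I_n.+1)
    (f : {poly R}) : R^o :=
  \sum_(j < k.+1) 'C(k, j)%:R / 'C(n, j)%:R * (j`!%:R)^-1 * (f^`(j)).[0].

Fact dual_bernstein_is_linear (R : realType) (n : nat) (k : 'I_n.+1) :
  linear (@dual_bernstein R n k).
Proof.
move=> a p q; rewrite /dual_bernstein scaler_sumr -big_split /=.
apply: eq_bigr => j _; rewrite derivnD derivnZ hornerD hornerZ mulrDr.
by congr (_ + _); rewrite /GRing.scale /= mulrCA.
Qed.

HB.instance Definition _ (R : realType) (n : nat) (k : 'I_n.+1) :=
  GRing.isLinear.Build R {poly R} R^o *:%R (@dual_bernstein R n k)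
    (dual_bernstein_is_linear k).

(* The binomials vanish when i < j or n - i < m - j. *)
Definition elevation (R : realType) (m n : nat) : 'M[R]_(n.+1, m.+1) :=
  \matrix_(i < n.+1, j < m.+1)
    (('C(n - i, m - j) * 'C(i, j))%:R / 'C(n, m)%:R).

Definition restriction (R : realType) (m : nat)
    (phi : {linear {poly R} -> R^o}) : 'Hom({poly_m.+1 R}, R^o) :=
  linfun (fun p : {poly_m.+1 R} => phi (polyn p)).

Fact restrictionE (R : realType) (m : nat)
    (phi : {linear {poly R} -> R^o}) (p : {poly_m.+1 R}) :
  restriction m phi p = phi (polyn p).
Proof. exact: (lfunE (phi \o @polyn R m.+1)). Qed.

Definition independent_on (R : realType) (m k : nat)
    (phi : 'I_k -> {linear {poly R} -> R^o}) : Prop :=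
  free [seq restriction m (phi i) | i <- enum 'I_k].

Definition complete_embedding (R : realType) (m n : nat)
    (Lambda : 'I_n.+1 -> {linear {poly R} -> R^o}) : Prop :=
  forall s : 'I_m.+1 -> 'I_n.+1, injective s ->
    independent_on m (fun i => Lambda (s i)).

Definition dual_basis (R : realType) (m : nat)
    (phi : 'I_m.+1 -> {linear {poly R} -> R^o})
    (D : (m.+1).-tuple {poly_m.+1 R}) : Prop :=
  basis_of fullv D /\
  forall i j : 'I_m.+1, phi i (polyn (tnth D j)) = (i == j)%:R.

(* Main.v *)
(* On a polynomial f of degree at most m, the value of the k-th dual functional
   of degree n is a polynomial in k of degree at most m, whose Newton
   coefficients are the nonzero multiples f`_l / 'C(n, l) of the coefficients
   of f.  If m + 1 of these functionals kill f, this polynomial in k has m + 1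
   distinct roots, hence it and f vanish.  Since the k-th functional takes the
   value E k j on the j-th Bernstein polynomial of degree m, any m + 1 rows of
   E form an invertible matrix, and everything follows. *)
Require Import Defs.
From mathcomp Require Import all_boot all_order all_algebra.
From mathcomp Require Import reals.
Import GRing.Theory.
Local Open Scope ring_scope.

(** * Binomial identities behind degree elevation *)

Lemma mul_bin_bin (n i l : nat) : (i <= l)%N ->
  ('C(n, i) * 'C(n - i, l - i) = 'C(n, l) * 'C(l, i))%N.
Proof.
move=> le_il; have [lt_nl | le_ln] := ltnP n l.
  rewrite (bin_small lt_nl) mul0n; have [lt_ni | le_in] := ltnP n i.
    by rewrite bin_small.
  by rewrite [X in (_ * X)%N]bin_small ?muln0 // ltn_sub2r // (leq_ltn_trans le_in).
have le_in := leq_trans le_il le_ln.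
apply/eqP; rewrite -(@eqn_pmul2r (i`! * ((l - i)`! * (n - l)`!))) ?muln_gt0 ?fact_gt0 //.
apply/eqP; transitivity n`!.
  rewrite -(bin_fact le_in) -(bin_fact (leq_sub2r i le_ln)).
  by rewrite -subnDA subnKC // mulnACA -!mulnA.
by rewrite -(bin_fact le_ln) -(bin_fact le_il) !mulnA.
Qed.

(** Both sides count the pairs of subsets of an [n]-set, of sizes [m] and [i], that meet in exactly
    [j] elements. *)
Lemma mul_bin_elevation (m n i j : nat) : (j <= m)%N -> (j <= i)%N ->
  ('C(m, j) * 'C(n - m, i - j) * 'C(n, m)
     = 'C(n - i, m - j) * 'C(i, j) * 'C(n, i))%N.
Proof.
move=> le_jm le_ji.
have swap N a b : ('C(N, a) * 'C(N - a, b) = 'C(N, b) * 'C(N - b, a))%N.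
  rewrite -[b in LHS](addKn a) mul_bin_bin ?leq_addr //.
  rewrite -[a in RHS](addnK b) mul_bin_bin ?leq_addl //.
  by rewrite -[in LHS](bin_sub (leq_addr b a)) addKn.
have sub_sub k : (j <= k)%N -> (n - j - (k - j) = n - k)%N.
  by move=> le_jk; rewrite -subnDA subnKC.
rewrite mulnAC [X in (X * _)%N]mulnC -mul_bin_bin // -!(sub_sub m) // -mulnA swap.
by rewrite mulnA mul_bin_bin // sub_sub // mulnC mulnA mulnAC.
Qed.

(** * Coefficients, duality and degree elevation of Bernstein polynomials *)

Section DualBernstein.
Variable R : realType.
Implicit Types f : {poly R}.

Lemma natr_bin_neq0 {n k : nat} : (k <= n)%N -> 'C(n, k)%:R != 0 :> R.
Proof. by move=> le_kn; rewrite Num.Theory.pnatr_eq0 -lt0n bin_gt0. Qed.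

Lemma dual_bernsteinE n (k : 'I_n.+1) f :
  dual_bernstein k f = \sum_(l < k.+1) 'C(k, l)%:R / 'C(n, l)%:R * f`_l.
Proof.
apply: eq_bigr => l _; rewrite horner_coef0 coef_derivn addn0 ffactnn.
rewrite -[f`_l *+ _]mulr_natr mulrACA mulVf ?mulr1 //.
by rewrite Num.Theory.pnatr_eq0 -lt0n fact_gt0.
Qed.

Lemma coef_1subXn p d : ((1 - 'X : {poly R}) ^+ p)`_d = (-1) ^+ d *+ 'C(p, d).
Proof.
rewrite exprDn coef_sum.
transitivity (\sum_(i < p.+1 | i == d :> nat) ((-1) ^+ d *+ 'C(p, d) : R)).
  rewrite [RHS]big_mkcond; apply: eq_bigr => i _.
  rewrite expr1n mul1r (exprNn 'X) coefMn -(rmorph_sign (@polyC R)) coefCM coefXn.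
  by rewrite eq_sym; case: eqP => [-> | _]; rewrite ?mulr1 // mulr0 mul0rn.
have [le_dp | lt_pd] := leqP d p; last first.
  by rewrite big1 ?bin_small // => i _; rewrite mulr0n.
by rewrite (big_pred1 (Ordinal (le_dp : d < p.+1)%N)).
Qed.

(** For [l < i] the exponent is truncated to 0, but then ['C(l, i)] vanishes. *)
Lemma coef_bernstein n i l :
  (bernstein R n i)`_l = ('C(n, l) * 'C(l, i))%:R * (-1) ^+ (l - i).
Proof.
rewrite coefZ coefMXn; case: ltnP => [lt_li | le_il].
  by rewrite (bin_small lt_li) muln0 mulr0 mul0r.
by rewrite coef_1subXn -[_ ^+ _ *+ _]mulr_natr mulrCA -natrM mul_bin_bin // mulrC.
Qed.

Lemma size_bernstein n i : (size (bernstein R n i) <= n.+1)%N.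
Proof.
apply/leq_sizeP => l lt_nl.
by rewrite coef_bernstein bin_small // mul0n mul0r.
Qed.

(* The coefficients of B^n_i divided by 'C(n, l) do not depend on n, so that
   the value of the functional is the value of B^k_i at 1. *)
Lemma dual_bernstein_bernstein n (k i : 'I_n.+1) :
  dual_bernstein k (bernstein R n i) = (k == i)%:R.
Proof.
transitivity (bernstein R k i).[1].
  rewrite (horner_coef_wide _ (size_bernstein k i)) dual_bernsteinE.
  apply: eq_bigr => l _; rewrite expr1n mulr1 !coef_bernstein !natrM !mulrA.
  rewrite divfK ?natr_bin_neq0 //.
  by rewrite (leq_trans (leq_ord l)) // leq_ord.
(* With truncated subtraction, [0 ^+ (k - i)] vanishes only for [i < k]; for [k < i] it is the
   binomial that vanishes. *)
rewrite !hornerE subrr expr1n expr0n subn_eq0.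
rewrite -val_eqE /= mulr1; case: ltngtP => [lt_ki | lt_ik | eq_ki].
- by rewrite bin_small ?mul0r.
- by rewrite mulr0.
- by rewrite eq_ki binn mulr1.
Qed.

(** Multiply by [1 = ((1 - 'X) + 'X) ^+ (n - m)] and expand the power. *)
Lemma bernstein_elevation {m n : nat} (j : 'I_m.+1) : (m <= n)%N ->
  bernstein R m j
    = \sum_(i < n.+1) elevation R m n i j *: bernstein R n i.
Proof.
move=> le_mn; have le_jm := leq_ord j.
(* The coefficients produced by that expansion. The test excludes [i < j], where the truncated
   [i - j] would make the second binomial 1. *)
pose G i : {poly R} :=
  (if (j <= i)%N then ('C(m, j) * 'C(n - m, i - j))%:R else 0)
    *: ((1 - 'X) ^+ (n - i) * 'X ^+ i).
transitivity (\sum_(i < n.+1) G i); last first.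
  apply: eq_bigr => i _; rewrite /G /bernstein mxE scalerA; congr (_ *: _).
  case: leqP => [le_ji | lt_ij]; last first.
    by rewrite (bin_small lt_ij) muln0 !mul0r.
  apply: (mulIf (natr_bin_neq0 le_mn)).
  by rewrite mulrAC divfK ?natr_bin_neq0 // -!natrM mul_bin_elevation.
(* Only the indices from [j] to [j + (n - m)] contribute; the sum is cut down to them, then shifted
   by [j]. *)
have le_n : (j + (n - m) <= n)%N by rewrite -leq_subRL ?leq_sub2l // (leq_trans le_jm).
rewrite -(big_mkord xpredT G) (@big_cat_nat _ _ _ j) ?leqW ?(leq_trans le_jm) //=.
rewrite big_nat big1 ?add0r; last by move=> i /andP[_ lt_ij]; rewrite /G leqNgt lt_ij scale0r.
rewrite (@big_cat_nat _ _ _ (j + (n - m)).+1) ?ltnS ?leqW ?leq_addr //=.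
rewrite [X in _ + X]big_nat [X in _ + X]big1 ?addr0; last first.
  move=> i /andP[lt_i _]; rewrite /G; case: leqP => [le_ji | _]; last by rewrite scale0r.
  by rewrite -ltn_subRL in lt_i; rewrite (bin_small lt_i) muln0 scale0r.
rewrite -addnS -[X in \sum_(X <= _ < _) _]add0n big_addn addKn big_mkord.
rewrite /bernstein -[in LHS](mulr1 ((1 - 'X) ^+ _ * _)).
rewrite -[X in _ * X](expr1n _ (n - m)) -[X in X ^+ (n - m)](subrK 'X 1).
rewrite [X in _ * X]exprDn mulr_sumr scaler_sumr; apply: eq_bigr => r _.
rewrite /G leq_addl addnK -scaler_nat -!scalerAr !scalerA -natrM; congr (_ *: _).
rewrite mulrACA -!exprD addnC; congr (_ ^+ _ * _ ^+ _); last by rewrite addnC.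
rewrite addnC addnBA ?leq_ord // [(m - j + _)%N]addnC addnBA // subnK //.
by rewrite addnC subnDA.
Qed.

Lemma dual_bernstein_elevation (m n : nat) (k : 'I_n.+1) (j : 'I_m.+1) :
  (m <= n)%N -> dual_bernstein k (bernstein R m j) = elevation R m n k j.
Proof.
move=> le_mn; rewrite (bernstein_elevation j le_mn) linear_sum (bigD1 k) //=.
rewrite linearZ /= dual_bernstein_bernstein eqxx big1 ?addr0 => [|i ne_ik].
  exact: mulr1.
by rewrite linearZ /= dual_bernstein_bernstein eq_sym (negPf ne_ik) scaler0.
Qed.

(** * Newton expansion and unisolvence of the functionals *)

Lemma poly_bin (l : nat) : {p : {poly R} | (size p <= l.+1)%N
  & forall k : nat, p.[k%:R] = 'C(k, l)%:R}.
Proof.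
elim: l => [|l [p sz_p pE]].
  by exists 1; [rewrite size_poly1 | move=> k; rewrite hornerE bin0].
exists (l.+1%:R^-1 *: (p * ('X - l%:R%:P))).
  rewrite (leq_trans (size_scale_leq _ _)) // (leq_trans (size_polyMleq _ _)) //.
  by rewrite size_XsubC addn2.
have l1_neq0 : l.+1%:R != 0 :> R by rewrite Num.Theory.pnatr_eq0.
move=> k; rewrite !hornerE /= pE; apply: (mulfI l1_neq0).
rewrite -mulrA mulVKf // -natrM mul_bin_left natrM.
(* The natural number [k - l] agrees with the difference in [R] only for [l <= k]; otherwise
   ['C(k, l)] is 0. *)
have [le_lk | lt_kl] := leqP l k; first by rewrite natrB // mulrC.
by rewrite bin_small // !(mulr0, mul0r).
Qed.

(** The system is triangular: at [k = l] the terms above [l] vanish, those below vanish by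
    induction, and ['C(l, l)] is 1. *)
Lemma newton_eq0 (m : nat) (c : 'I_m.+1 -> R) :
  (forall k : nat, \sum_(l < m.+1) c l * 'C(k, l)%:R = 0) -> forall l, c l = 0.
Proof.
move=> c0 l; have [k] := ubnP l; elim: k => // k IHk in l * => lt_lk.
have := c0 l; rewrite (bigD1 l) //= binn mulr1 big1 ?addr0 // => i ne_il.
have [lt_li | lt_il | eq_il] := ltngtP l i.
- by rewrite bin_small ?mulr0.
- by rewrite IHk ?mul0r // (leq_trans lt_il).
- by rewrite (val_inj eq_il) eqxx in ne_il.
Qed.

Lemma dual_bernstein_inj {m n : nat} {s : 'I_m.+1 -> 'I_n.+1} {f} :
    (m <= n)%N -> injective s -> (size f <= m.+1)%N ->
  (forall i, dual_bernstein (s i) f = 0) -> f = 0.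
Proof.
move=> le_mn s_inj sz_f sf0.
pose c (l : 'I_m.+1) := f`_l / 'C(n, l)%:R.
pose q := \sum_(l < m.+1) c l *: s2val (poly_bin l).
have qE (k : nat) : q.[k%:R] = \sum_(l < m.+1) c l * 'C(k, l)%:R.
  rewrite horner_sum; apply: eq_bigr => l _.
  by rewrite hornerZ (s2valP' (poly_bin l)).
have dualE (k : 'I_n.+1) : dual_bernstein k f = q.[k%:R].
  rewrite qE dual_bernsteinE.
  pose F l : R := 'C(k, l)%:R / 'C(n, l)%:R * f`_l.
  (* Whichever sum is longer, its extra terms vanish: through ['C(k, l)] if [k < l], through the
     coefficient of [f] if [m < l]. *)
  have eqF : \sum_(l < k.+1) F l = \sum_(l < m.+1) F l.
    case/orP: (leq_total k m); rewrite -ltnS => le_km.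
      rewrite (big_ord_widen _ F le_km) big_mkcond; apply: eq_bigr => l _.
      by case: ltnP => // lt_kl; rewrite /F bin_small ?mul0r.
    rewrite [RHS](big_ord_widen _ F le_km) [RHS]big_mkcond; apply: eq_bigr => l _.
    by case: ltnP => // lt_ml; rewrite /F [f`_l]nth_default ?mulr0 // (leq_trans sz_f).
  by rewrite [LHS]eqF; apply: eq_bigr => l _; rewrite /F /c mulrC mulrCA mulrC.
have q0 : q = 0.
  (* The roots [s i] stay distinct in [R], which has characteristic 0. *)
  apply: (@roots_geq_poly_eq0 _ _ [seq (s i)%:R | i <- enum 'I_m.+1]).
  - by apply/allP => _ /mapP[i _ ->]; apply/rootP; rewrite -dualE sf0.
  - rewrite map_inj_uniq ?enum_uniq // => i j /eqP.
    by rewrite Num.Theory.eqr_nat => /eqP/val_inj/s_inj.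
  - rewrite size_map size_enum_ord (leq_trans (size_sum _ _ _)) //.
    apply/bigmax_leqP => l _; rewrite (leq_trans (size_scale_leq _ _)) //.
    by rewrite (leq_trans (s2valP (poly_bin l))).
have c0 : forall l, c l = 0.
  by apply: newton_eq0 => k; rewrite -qE q0 horner0.
apply/polyP => l; rewrite coef0; have [le_ml | lt_lm] := leqP m.+1 l.
  by rewrite nth_default // (leq_trans sz_f).
have /eqP := c0 (Ordinal lt_lm); rewrite mulf_eq0 invr_eq0.
by rewrite (negPf (natr_bin_neq0 (@leq_trans m l n lt_lm le_mn))) orbF => /eqP.
Qed.

(** * Invertibility of the selected rows, and completeness *)

Definition bernstein_npoly (m : nat) (i : 'I_m.+1) : {poly_m.+1 R} :=
  npolyp m.+1 (bernstein R m i).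

Lemma bernstein_npolyE m i : polyn (bernstein_npoly m i) = bernstein R m i.
Proof. exact/npolypK/size_bernstein. Qed.

Lemma elevation_unitmx {m n : nat} {s : 'I_m.+1 -> 'I_n.+1} :
  (m <= n)%N -> injective s -> rowsub s (elevation R m n) \in unitmx.
Proof.
(* After transposition, a kernel vector [v] lists the Bernstein coefficients of a polynomial [f]
   killed by all selected functionals. *)
move=> le_mn s_inj; rewrite -unitmx_tr -row_free_unit; apply: inj_row_free => v vE.
pose f : {poly_m.+1 R} := \sum_j v 0 j *: bernstein_npoly m j.
have polynf : polyn f = \sum_j v 0 j *: bernstein R m j.
  by rewrite linear_sum; apply: eq_bigr => j _; rewrite linearZ /= bernstein_npolyE.
have f0 : polyn f = 0.
  apply: (dual_bernstein_inj le_mn s_inj (size_npoly f)) => i.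
  have /rowP/(_ i) := vE; rewrite !mxE => <-; rewrite polynf linear_sum.
  by apply: eq_bigr => j _; rewrite linearZ /= dual_bernstein_elevation // !mxE.
(* The functionals of degree [m] read the coefficients [v 0 i] off [f = 0]. *)
apply/rowP => i; have := congr1 (@dual_bernstein R m i) f0.
rewrite polynf linear0 linear_sum (bigD1 i) //= linearZ big1 ?addr0 => [|j ne_ji].
  by rewrite /= dual_bernstein_bernstein eqxx mxE => <-; rewrite /GRing.scale /= mulr1.
by rewrite linearZ /= dual_bernstein_bernstein eq_sym (negPf ne_ji) scaler0.
Qed.

(** Evaluated on the Bernstein basis, a linear relation between the functionals becomes a row vector
    killed by an invertible matrix. *)
Lemma dual_bernstein_complete (m n : nat) : (m <= n)%N ->
  complete_embedding m (fun k : 'I_n.+1 => @dual_bernstein R n k).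
Proof.
move=> le_mn s s_inj; rewrite /independent_on.
set X := [seq _ | i <- _].
have szX : size X == m.+1 by rewrite size_map size_enum_ord.
apply/(@freeP _ _ _ (Tuple szX)) => c cX0.
have: \row_i c i *m rowsub s (elevation R m n) = 0.
  apply/rowP => j; rewrite !mxE.
  have /(congr1 (fun u : 'Hom(_, _) => u (bernstein_npoly m j))) := cX0.
  rewrite sum_lfunE lfunE /= => cj0; rewrite -[RHS]cj0; apply: eq_bigr => i _.
  rewrite !mxE scale_lfunE (nth_map i) ?size_enum_ord // nth_ord_enum.
  by rewrite restrictionE bernstein_npolyE /= dual_bernstein_elevation // mxE.
move/(congr1 (mulmx^~ (invmx (rowsub s (elevation R m n))))).
rewrite mulmxK ?elevation_unitmx // mul0mx => /rowP c0 i.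
by have := c0 i; rewrite !mxE.
Qed.

(** Applying [phi i] to a linear relation isolates its [i]-th coefficient, so [D] is free; its
    length is the dimension. *)
Lemma biorthogonal_dual_basis (m : nat) (phi : 'I_m.+1 -> {linear {poly R} -> R^o})
    (D : (m.+1).-tuple {poly_m.+1 R}) :
  (forall i j : 'I_m.+1, phi i (polyn (tnth D j)) = (i == j)%:R) ->
  dual_basis phi D.
Proof.
move=> phiD; split=> //; rewrite basisEfree subvf dim_polyn size_tuple leqnn !andbT.
apply/freeP => c cD0 i; have := congr1 (phi i \o @polyn R m.+1) cD0.
rewrite /= !linear0 linear_sum linear_sum (bigD1 i) //= big1 ?addr0 => [|j ne_ji].
  by rewrite !linearZ_LR /= -tnth_nth phiD eqxx => <-; rewrite /GRing.scale /= mulr1.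
by rewrite !linearZ_LR /= -tnth_nth phiD eq_sym (negPf ne_ji) scaler0.
Qed.

End DualBernstein.

Theorem theorem4p1 (R : realType) (m n : nat) (le_mn : (m <= n)%N) :
  complete_embedding m (fun k : 'I_n.+1 => @dual_bernstein R n k)
  /\
  (forall s : 'I_m.+1 -> 'I_n.+1, injective s ->
     rowsub s (elevation R m n) \in unitmx /\
     exists D : (m.+1).-tuple {poly_m.+1 R},
       [/\ dual_basis (fun i => @dual_bernstein R n (s i)) D,
           (forall D' : (m.+1).-tuple {poly_m.+1 R},
              dual_basis (fun i => @dual_bernstein R n (s i)) D' -> D' = D),
           \row_j polyn (tnth D j)
             = bernstein_row R m
                 *m map_mx polyC (invmx (rowsub s (elevation R m n))),
           (m = n -> forall j : 'I_m.+1,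
              polyn (tnth D j) = bernstein R m (s j))
         & (m = n -> (forall i : 'I_m.+1, s i = i :> nat) ->
              \row_j polyn (tnth D j) = bernstein_row R m)]).
Proof.
split=> [|s s_inj]; first exact: dual_bernstein_complete.
have E_unit := elevation_unitmx R le_mn s_inj; split=> //.
set M := rowsub s _ in E_unit *.
have eq_on_duals (f g : {poly R}) : (size f <= m.+1)%N -> (size g <= m.+1)%N ->
    (forall i, dual_bernstein (s i) f = dual_bernstein (s i) g) -> f = g.
  move=> sz_f sz_g fg; apply/subr0_eq/(dual_bernstein_inj R le_mn s_inj) => [|i].
    by rewrite (leq_trans (size_polyD _ _)) // size_polyN geq_max sz_f.
  by rewrite linearB /= fg subrr.
pose d j : {poly_m.+1 R} := \sum_i invmx M i j *: bernstein_npoly R m i.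
have dE j : polyn (d j) = \sum_i invmx M i j *: bernstein R m i.
  by rewrite linear_sum; apply: eq_bigr => i _; rewrite linearZ /= bernstein_npolyE.
have phid i j : dual_bernstein (s i) (polyn (d j)) = (i == j)%:R.
  (* Biorthogonality is the identity [M *m invmx M = 1] read entrywise. *)
  rewrite dE linear_sum; have /matrixP/(_ i j) := mulmxV E_unit.
  rewrite !mxE => <-; apply: eq_bigr => k _.
  by rewrite linearZ /= dual_bernstein_elevation // mulrC !mxE.
pose D := [tuple d j | j < m.+1].
have phiD i j : dual_bernstein (s i) (polyn (tnth D j)) = (i == j)%:R.
  by rewrite tnth_mktuple.
(* For [m = n] the polynomials [bernstein R m (s j)] satisfy the same duality relations, so [D] is
   the Bernstein basis permuted by [s]. *)
have Ds : m = n -> forall j, polyn (tnth D j) = bernstein R m (s j).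
  move=> eq_mn j; apply: eq_on_duals => [||i]; rewrite ?size_npoly ?size_bernstein //.
  by rewrite phiD [X in bernstein R X _]eq_mn dual_bernstein_bernstein (inj_eq s_inj).
exists D; split=> //.
- exact: biorthogonal_dual_basis.
- move=> D' [_ phiD']; apply: eq_from_tnth => j; apply: val_inj.
  by apply: eq_on_duals => [||i]; rewrite ?size_npoly // phiD phiD'.
- apply/rowP => j; rewrite !mxE tnth_mktuple dE; apply: eq_bigr => i _.
  by rewrite !mxE -mul_polyC mulrC.
- by move=> eq_mn s_id; apply/rowP => j; rewrite !mxE Ds // s_id.
Qed.
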